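(* Assume that $N=-\lambda_1-\alpha_1$ is a non-negative integer, $0<q<1$, and $t_1,t_2,h_1,h_2,l_1,l_2,\alpha_1,\alpha_2,\beta$ are all real. If one of the following conditions is satisfied, then the equation $c_{N+1}(E)=0$ (where $c_{N+1}(E)$ is the polynomial in $E$ defined in the context) has all its roots real and distinct: (i) $t_1t_2>0$, $\alpha_2-\alpha_1<1$ and $\beta<1$; (ii) $t_1t_2>0$, $\alpha_2-\alpha_1>N$ and $\beta>N$; (iii) $t_1t_2<0$, $\alpha_2-\alpha_1>N$ and $\beta<1$; (iv) $t_1t_2<0$, $\alpha_2-\alpha_1<1$ and $\beta>N$.
   Context: Set $\lambda_1=(h_1+h_2-l_1-l_2-\alpha_1-\alpha_2-\beta+2)/2$. Polynomials $c_n(E)$ (the last one, $c_{N+1}(E)$, is the spectral polynomial of the $q$-Heun equation): $c_{-1}(E)=0$, $c_0(E)=1$. For every $n\ge1$ put $$R_n(E)=c_{n-1}(E)\Big[Eq^{n-1+\lambda_1}+q^{1/2}(q^{h_1}t_1+q^{h_2}t_2)+(q^{l_1}t_1+q^{l_2}t_2)q^{2(n-1+\lambda_1)+\alpha_1+\alpha_2-1/2}\Big]$$ $$-c_{n-2}(E)\,q\,(1-q^{n-2+\lambda_1+\alpha_1})(1-q^{n-2+\lambda_1+\alpha_2}).$$ For $n=1,\dots,N$, $c_n(E)$ is determined recursively by $c_n(E)\,t_1t_2q^{h_1+h_2}(1-q^n)(1-q^{n-\beta})=R_n(E)$ (in each of the cases (i)–(iv), $\beta\notin\{1,\dots,N\}$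 and $t_1t_2\ne0$, so this is possible). The polynomial $c_{N+1}(E)$ is determined by the same relation with $n=N+1$ if $N+1-\beta\ne0$, and by $c_{N+1}(E)=R_{N+1}(E)$ if $N+1-\beta=0$. *)

(* Defs.v *)
From HB Require Import structures.
From mathcomp Require Import all_boot all_order all_algebra.
From mathcomp Require Import complex.
From mathcomp Require Import reals exp.

Set Implicit Arguments.
Unset Strict Implicit.
Unset Printing Implicit Defensive.

Import Order.TTheory GRing.Theory Num.Theory.
Local Open Scope ring_scope.

(* "The equation p(E) = 0 has all its roots real and distinct": the roots are
   taken in the complex numbers and counted with multiplicity. *)
Definition roots_real_distinct (R : realType) (p : {poly R}) : Prop :=
  let pC := map_poly (real_complex R) p in
  pC != 0 /\ forall z : R[i], root pC z -> z \is Num.real /\ mup z pC = 1%N.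

Record qheun_param (R : realType) := QHeunParam {
  qh_q : R;
  qh_t1 : R;
  qh_t2 : R;
  qh_h1 : R;
  qh_h2 : R;
  qh_l1 : R;
  qh_l2 : R;
  qh_alpha1 : R;
  qh_alpha2 : R;
  qh_beta : R
}.

Definition lambda1 (R : realType) (h1 h2 l1 l2 alpha1 alpha2 beta : R) : R :=
  (h1 + h2 - l1 - l2 - alpha1 - alpha2 - beta + 2) / 2.

(* R_n, as a function of c1 = c_{n-1} and c2 = c_{n-2}; 'X is the variable E *)
Definition qheun_rhs (R : realType) (P : qheun_param R) (n : nat)
    (c1 c2 : {poly R}) : {poly R} :=
  let: QHeunParam q t1 t2 h1 h2 l1 l2 alpha1 alpha2 beta := P in
  let lam := lambda1 h1 h2 l1 l2 alpha1 alpha2 beta in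
  c1 * (q `^ (n%:R - 1 + lam) *: 'X
        + (q `^ (1 / 2) * (q `^ h1 * t1 + q `^ h2 * t2))%:P
        + ((q `^ l1 * t1 + q `^ l2 * t2)
           * q `^ (2 * (n%:R - 1 + lam) + alpha1 + alpha2 - 1 / 2))%:P)
  - (q * (1 - q `^ (n%:R - 2 + lam + alpha1))
       * (1 - q `^ (n%:R - 2 + lam + alpha2))) *: c2.

(* the coefficient of c_n on the left-hand side of the recurrence *)
Definition qheun_lhs_coef (R : realType) (P : qheun_param R) (n : nat) : R :=
  let: QHeunParam q t1 t2 h1 h2 l1 l2 alpha1 alpha2 beta := P in
  t1 * t2 * q `^ (h1 + h2) * (1 - q `^ n%:R) * (1 - q `^ (n%:R - beta)).

(* The pair (c_n, c_{n-1}), with c_0 = 1 and c_{-1} = 0. It is meaningful only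
   as long as the coefficients divided by are nonzero. *)
Fixpoint qheun_coef_pair (R : realType) (P : qheun_param R) (n : nat) :
    {poly R} * {poly R} :=
  if n is m.+1 then
    let: (c1, c2) := qheun_coef_pair P m in
    ((qheun_lhs_coef P m.+1)^-1 *: qheun_rhs P m.+1 c1 c2, c1)
  else (1, 0).

(* c_{N+1} *)
Definition qheun_spectral_poly (R : realType) (P : qheun_param R) (N : nat) :
    {poly R} :=
  let: (c1, c2) := qheun_coef_pair P N in
  let r := qheun_rhs P N.+1 c1 c2 in
  if N.+1%:R - qh_beta P == 0 then r
  else (qheun_lhs_coef P N.+1)^-1 *: r.

(* Main.v *)
Require Import Defs.
From mathcomp Require Import all_boot all_order all_algebra.
From mathcomp Require Import reals.
From mathcomp Require Import complex exp ring lra.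
Import Order.TTheory GRing.Theory Num.Theory.
Local Open Scope ring_scope.

(** Dividing each step of the recurrence by the factor on its left-hand side
    gives p_(n+1) = (a_n X + b_n) p_n - c_n p_(n-1) with real coefficients, and
    Favard's condition a_n a_(n+1) c_(n+1) > 0 holds in each of the four cases:
    for 0 < q < 1 the factor 1 - q^x has the sign of x, so only the signs of
    t1 t2, of n + 1 - beta and of n - N + alpha2 - alpha1 for 0 <= n < N matter
    ([qheun_sign_condition]).  When N + 1 = beta the last step is left
    undivided; this only rescales the last polynomial, and does not disturb the
    sign condition.

    The roots are then read off the Christoffel-Darboux kernel
    K(x, y) = (p_n(x) p_(n-1)(y) - p_(n-1)(x) p_n(y)) / (x - y), which the
    recurrence writes as a sum of products p_k(x) p_k(y) with weights of one
    sign.  At y = conj x the products are |p_k(x)|^2 and the kernel does not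
    vanish ([cd_kernel_conj_gt0]), for real and non-real x alike.  A root z of
    p_n is also paired with the root conj z, so (z - conj z) K(z, conj z) = 0
    and z is real ([christoffel_darboux]).  Then K(z, z) = p_n'(z) p_(n-1)(z)
    is nonzero ([christoffel_darboux_confluent]), and z is a simple root. *)

(** * Three-term recurrences and the Christoffel-Darboux kernel *)

Section ThreeTerm.

Context {S : comNzRingType} (a b c : nat -> S).

Fixpoint three_term (n : nat) : {poly S} * {poly S} :=
  if n is m.+1 then
    let: (p1, p2) := three_term m in
    (p1 * (a m *: 'X + (b m)%:P) - c m *: p2, p1)
  else (1, 0).

(** The quotient (p_n(x) p_(n-1)(y) - p_(n-1)(x) p_n(y)) / (x - y), defined
    through its own recurrence so that it makes sense at x = y. *)
Fixpoint cd_kernel (x y : S) (n : nat) : S :=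
  if n is m.+1 then
    a m * ((three_term m).1.[x] * (three_term m).1.[y])
      + c m * cd_kernel x y m
  else 0.

Lemma christoffel_darboux x y n :
  (x - y) * cd_kernel x y n =
  (three_term n).1.[x] * (three_term n).2.[y]
    - (three_term n).2.[x] * (three_term n).1.[y].
Proof.
elim: n => [|n IHn] /=; first by rewrite !hornerE; ring.
rewrite mulrDr (mulrCA _ (c n)) IHn.
by case: (three_term n) => p1 p2 /=;
  rewrite !(hornerD, hornerN, hornerM, hornerZ, hornerX, hornerC); ring.
Qed.

Lemma christoffel_darboux_confluent x n :
  cd_kernel x x n =
  (three_term n).1^`().[x] * (three_term n).2.[x]
    - (three_term n).2^`().[x] * (three_term n).1.[x].
Proof.
elim: n => [|n IHn] /=; first by rewrite -polyC1 derivC deriv0 !hornerE oppr0.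
rewrite IHn.
by case: (three_term n) => p1 p2 /=; rewrite !derivE;
  rewrite !(hornerD, hornerN, hornerM, hornerZ, hornerX, hornerC); ring.
Qed.

End ThreeTerm.

Lemma map_three_term {S T : comNzRingType} (f : {rmorphism S -> T})
    (a b c : nat -> S) n :
  (map_poly f (three_term a b c n).1, map_poly f (three_term a b c n).2) =
  three_term (f \o a) (f \o b) (f \o c) n.
Proof.
elim: n => [|n IHn] /=; first by rewrite rmorph1 rmorph0.
rewrite -IHn; case: (three_term a b c n) => p1 p2 /=.
by rewrite rmorphB rmorphM rmorphD /= !map_polyZ map_polyX map_polyC.
Qed.

(** * Favard's condition forces real simple roots *)

Lemma simple_root_mup (F : fieldType) (p : {poly F}) z :
  root p z -> p^`().[z] != 0 -> mup z p = 1%N.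
Proof.
move=> pz dpz.
have p0 : p != 0.
  by apply: contra_neq dpz => ->; rewrite deriv0 horner0.
apply/eqP; rewrite eqn_leq mup_geq // expr1 dvdp_XsubCl pz andbT.
rewrite -ltnS mup_ltn //.
apply: contraNN dpz => /dvdpP [r ->].
by rewrite expr2 !derivM
  !(hornerXsubC, hornerD, hornerM) subrr !(mul0r, mulr0, addr0).
Qed.

Section Favard.

Context {C : numClosedFieldType} (a b c : nat -> C) (N : nat).
Hypotheses (a_real : forall n, a n \is Num.real)
  (b_real : forall n, b n \is Num.real) (c_real : forall n, c n \is Num.real).
Hypothesis a0_neq0 : a 0%N != 0.
Hypothesis favard : forall n, (n < N)%N -> 0 < a n * a n.+1 * c n.+1.

Lemma three_term_conj z n :
  (three_term a b c n).1.[z^*] = (three_term a b c n).1.[z]^* /\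
  (three_term a b c n).2.[z^*] = (three_term a b c n).2.[z]^*.
Proof.
elim: n => [|n] /=; first by rewrite !hornerE rmorph1 rmorph0.
case: (three_term a b c n) => p1 p2 /= [IH1 IH2]; split => //.
rewrite !hornerE IH1 IH2 rmorphB !rmorphM rmorphD rmorphM /=.
by rewrite (conj_Creal (a_real _)) (conj_Creal (b_real _)) (conj_Creal (c_real _)).
Qed.

(** The induction carries the sign of the kernel relative to a_n: multiplying
    the kernel recurrence by a_(n+1) gives a square times |p_(n+1)(z)|^2, plus
    a_(n+1) c_(n+1) times the previous kernel, and Favard's condition says that
    the latter factor has the sign of a_n. *)
Lemma cd_kernel_conj_gt0 z n : (n <= N)%N ->
  0 < a n * cd_kernel a b c z z^* n.+1.
Proof.
have sqr_ge0 k : 0 <= a k ^+ 2 by rewrite -realEsqr.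
elim: n => [_|n IHn lt_nN].
  by rewrite /= !hornerC mulr0 addr0 !mulr1 -expr2 lt0r sqrf_eq0 a0_neq0 sqr_ge0.
have fav := favard _ lt_nN; have IH := IHn (ltnW lt_nN).
have an_neq0 : a n != 0.
  by apply: contraTneq fav => ->; rewrite !mul0r ltxx.
have an2_gt0 : 0 < a n ^+ 2 by rewrite lt0r sqrf_eq0 an_neq0 sqr_ge0.
rewrite -[cd_kernel _ _ _ _ _ _]/(a n.+1 * _ +
  c n.+1 * cd_kernel a b c z z^* n.+1).
rewrite (proj1 (three_term_conj z _)) mulrDr mulrA -expr2.
apply: ltr_wpDl; first exact: mulr_ge0 (sqr_ge0 _) (mul_conjC_ge0 _).
rewrite -(pmulr_rgt0 _ an2_gt0).
move: (mulr_gt0 fav IH); congr (_ < _); ring.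
Qed.

Theorem favard_roots (p := (three_term a b c N.+1).1) :
  p != 0 /\ forall z, root p z -> z \is Num.real /\ mup z p = 1%N.
Proof.
have K_neq0 z : cd_kernel a b c z z^* N.+1 != 0.
  apply: contraTneq (cd_kernel_conj_gt0 z N (leqnn N)) => ->.
  by rewrite mulr0 ltxx.
split.
  apply: contraNneq (K_neq0 0) => p0.
  rewrite rmorph0 christoffel_darboux_confluent -/p p0.
  by rewrite deriv0 !horner0 mul0r mulr0 subrr.
move=> z /[dup] pz /eqP pz0.
have z_real : z^* = z.
  apply/eqP; rewrite eq_sym -subr_eq0; apply/eqP.
  apply: (mulIf (K_neq0 z)); rewrite mul0r christoffel_darboux.
  by rewrite (proj1 (three_term_conj z _)) -/p pz0 rmorph0 mul0r mulr0 subrr.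
split; first exact/CrealP.
apply: simple_root_mup => //; apply: contraNneq (K_neq0 z) => dpz0.
by rewrite z_real christoffel_darboux_confluent -/p pz0 dpz0 mul0r mulr0 subrr.
Qed.

End Favard.

Lemma roots_real_distinct_three_term (R : realType) (a b c : nat -> R) (N : nat) :
    a 0%N != 0 -> (forall n, (n < N)%N -> 0 < a n * a n.+1 * c n.+1) ->
  roots_real_distinct (three_term a b c N.+1).1.
Proof.
move=> a0 fav; rewrite /roots_real_distinct.
have := map_three_term (real_complex R) a b c N.+1.
move=> /(congr1 fst) /= ->.
have real_realC (u : nat -> R) n : (real_complex R \o u) n \is Num.real.
  by apply/CrealP; apply: conjc_real.
apply: (favard_roots _ _ _ N); try exact: real_realC.
  by rewrite /= fmorph_eq0.
move=> n lt_nN; rewrite /=.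
by rewrite -!rmorphM -(rmorph0 (real_complex R)) ltcR; apply: fav.
Qed.

(** * Signs of the coefficients of the recurrence *)

Lemma sgr_1subpowR (R : realType) (q x : R) :
  0 < q < 1 -> Num.sg (1 - q `^ x) = Num.sg x.
Proof.
move=> /andP[q0 q1]; have lnq : ln q < 0 by rewrite ln_lt0 // q0.
rewrite /powR gt_eqF //; case: (ltrgt0P x) => [x0|x0|->].
- by rewrite !gtr0_sg // subr_gt0 expR_lt1 pmulr_rlt0.
- by rewrite !ltr0_sg // subr_lt0 expR_gt1 nmulr_rgt0.
- by rewrite mul0r expR0 subrr.
Qed.

Section QHeun.

Context {R : realType} (q t1 t2 h1 h2 l1 l2 alpha1 alpha2 beta : R).
Let P := QHeunParam q t1 t2 h1 h2 l1 l2 alpha1 alpha2 beta.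
Let lam := lambda1 h1 h2 l1 l2 alpha1 alpha2 beta.
Hypothesis hq : 0 < q < 1.

(** The value 1 at a vanishing coefficient is what makes the exceptional last
    step, N + 1 = beta, an instance of the same recurrence. *)
Let kappa (n : nat) : R :=
  if qheun_lhs_coef P n.+1 == 0 then 1 else (qheun_lhs_coef P n.+1)^-1.

Let low_coef (n : nat) : R :=
  q * (1 - q `^ (n.+1%:R - 2 + lam + alpha1))
    * (1 - q `^ (n.+1%:R - 2 + lam + alpha2)).

Let qa (n : nat) : R := kappa n * q `^ (n.+1%:R - 1 + lam).
Let qb (n : nat) : R :=
  kappa n * (q `^ (1 / 2) * (q `^ h1 * t1 + q `^ h2 * t2)
    + (q `^ l1 * t1 + q `^ l2 * t2)
      * q `^ (2 * (n.+1%:R - 1 + lam) + alpha1 + alpha2 - 1 / 2)).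
Let qc (n : nat) : R := kappa n * low_coef n.

Let q_gt0 : 0 < q. Proof. by case/andP: hq. Qed.

Let kappa_neq0 n : kappa n != 0.
Proof.
rewrite /kappa; case: ifPn => [_|]; first exact: oner_neq0.
by rewrite -invr_eq0.
Qed.

Lemma sgr_qheun_lhs_coef n :
  Num.sg (qheun_lhs_coef P n.+1) = Num.sg (t1 * t2 * (n.+1%:R - beta)).
Proof.
rewrite /= !(sgrM (_ * _)) !sgr_1subpowR // !sgrM.
by rewrite (gtr0_sg (powR_gt0 _ q_gt0)) (gtr0_sg (ltr0Sn _ _)) !mulr1.
Qed.

Lemma sgr_qheun_low_coef n :
  Num.sg (low_coef n) =
  Num.sg ((n.+1%:R - 2 + lam + alpha1) * (n.+1%:R - 2 + lam + alpha2)).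
Proof. by rewrite /low_coef !sgrM !sgr_1subpowR // (gtr0_sg q_gt0) mul1r. Qed.

Lemma scale_qheun_rhs n (c1 c2 : {poly R}) :
  kappa n *: qheun_rhs P n.+1 c1 c2
  = c1 * (qa n *: 'X + (qb n)%:P) - qc n *: c2.
Proof.
rewrite /= -/lam /qa /qb /qc /low_coef -!mul_polyC !polyCM !polyCD !polyCM.
ring.
Qed.

Lemma qheun_coef_pairE n :
    (forall k, (k < n)%N -> qheun_lhs_coef P k.+1 != 0) ->
  qheun_coef_pair P n = three_term qa qb qc n.
Proof.
elim: n => // n IHn lhs_neq0.
rewrite [LHS]/= [RHS]/= -IHn => [|k /ltnW]; last exact: lhs_neq0.
case: (qheun_coef_pair P n) => c1 c2; congr (_, _).
by rewrite -scale_qheun_rhs /kappa (negPf (lhs_neq0 n (leqnn _))).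
Qed.

Lemma qheun_spectral_polyE N :
    t1 * t2 != 0 ->
    (forall k, (k < N)%N -> qheun_lhs_coef P k.+1 != 0) ->
  qheun_spectral_poly P N = (three_term qa qb qc N.+1).1.
Proof.
move=> t_neq0 lhs_neq0; rewrite /qheun_spectral_poly qheun_coef_pairE //=.
case: (three_term qa qb qc N) => c1 c2; rewrite [RHS]/= -scale_qheun_rhs /kappa.
rewrite -[qheun_lhs_coef P N.+1 == 0]sgr_eq0 sgr_qheun_lhs_coef sgr_eq0.
by rewrite mulf_eq0 (negPf t_neq0) /=; case: ifP; rewrite ?scale1r.
Qed.

(** As lam + alpha1 = - N, the last two factors carry the exponents n - N and
    n - N + alpha2 - alpha1.  In each case the two inequalities fix the
    signs of n + 1 - beta and n - N + alpha2 - alpha1 uniformly in n < N, and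
    n - N is negative. *)
Lemma qheun_sign_condition (N : nat)
    (hN : N%:R = - lam - alpha1)
    (hcases :
      [\/ [/\ 0 < t1 * t2, alpha2 - alpha1 < 1 & beta < 1],
          [/\ 0 < t1 * t2, N%:R < alpha2 - alpha1 & N%:R < beta],
          [/\ t1 * t2 < 0, N%:R < alpha2 - alpha1 & beta < 1]
        | [/\ t1 * t2 < 0, alpha2 - alpha1 < 1 & N%:R < beta]]) n :
  (n < N)%N -> 0 < qheun_lhs_coef P n.+1 * low_coef n.+1.
Proof.
move=> lt_nN; rewrite -sgr_gt0 sgrM sgr_qheun_lhs_coef sgr_qheun_low_coef.
rewrite -sgrM sgr_gt0.
have nN : n.+1%:R <= N%:R :> R by rewrite ler_nat.
have n0 : 0 <= n%:R :> R by [].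
rewrite -[n.+2%:R]natr1 -[n.+1%:R]natr1 in nN *.
have u_lt0 : n%:R + 1 + 1 - 2 + lam + alpha1 < 0 by lra.
case: hcases => -[t_sgn d_sgn b_sgn].
- apply: mulr_gt0; first by apply: mulr_gt0 => //; lra.
  by rewrite nmulr_rgt0 //; lra.
- rewrite nmulr_rgt0; first by rewrite nmulr_rlt0 //; lra.
  by rewrite pmulr_rlt0 //; lra.
- rewrite nmulr_rgt0; first by rewrite nmulr_rlt0 //; lra.
  by rewrite nmulr_rlt0 //; lra.
- apply: mulr_gt0; first by rewrite nmulr_rgt0 //; lra.
  by rewrite nmulr_rgt0 //; lra.
Qed.

Lemma qheun_spectral_roots (N : nat) :
    t1 * t2 != 0 ->
    (forall n, (n < N)%N -> 0 < qheun_lhs_coef P n.+1 * low_coef n.+1) ->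
  roots_real_distinct (qheun_spectral_poly P N).
Proof.
move=> t_neq0 sgn_gt0.
have lhs_neq0 k : (k < N)%N -> qheun_lhs_coef P k.+1 != 0.
  by move=> /sgn_gt0; apply: contraTneq => ->; rewrite mul0r ltxx.
rewrite qheun_spectral_polyE //.
have pow_gt0 x : 0 < q `^ x by apply: powR_gt0.
apply: roots_real_distinct_three_term => [|n lt_nN].
  by rewrite mulf_neq0 ?kappa_neq0 // gt_eqF.
have kappa_low_gt0 : 0 < kappa n * low_coef n.+1.
  rewrite /kappa (negPf (lhs_neq0 _ lt_nN)).
  by rewrite -sgr_gt0 sgrM sgrV -sgrM sgr_gt0 sgn_gt0.
have kappa2_gt0 : 0 < kappa n.+1 ^+ 2 by rewrite exprn_even_gt0 ?kappa_neq0.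
have -> : qa n * qa n.+1 * qc n.+1 =
    q `^ (n.+1%:R - 1 + lam) * q `^ (n.+2%:R - 1 + lam)
    * (kappa n.+1 ^+ 2 * (kappa n * low_coef n.+1)).
  rewrite /qa /qc; ring.
exact: mulr_gt0 (mulr_gt0 (pow_gt0 _) (pow_gt0 _))
  (mulr_gt0 kappa2_gt0 kappa_low_gt0).
Qed.

End QHeun.

Theorem theorem3p2 (R : realType) (N : nat)
    (q t1 t2 h1 h2 l1 l2 alpha1 alpha2 beta : R)
    (hN : N%:R = - lambda1 h1 h2 l1 l2 alpha1 alpha2 beta - alpha1)
    (hq : 0 < q < 1)
    (hcases :
      [\/ [/\ 0 < t1 * t2, alpha2 - alpha1 < 1 & beta < 1],
          [/\ 0 < t1 * t2, N%:R < alpha2 - alpha1 & N%:R < beta],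
          [/\ t1 * t2 < 0, N%:R < alpha2 - alpha1 & beta < 1]
        | [/\ t1 * t2 < 0, alpha2 - alpha1 < 1 & N%:R < beta]]) :
  roots_real_distinct
    (qheun_spectral_poly
       (QHeunParam q t1 t2 h1 h2 l1 l2 alpha1 alpha2 beta) N).
Proof.
apply: (qheun_spectral_roots _ _ _ _ _ _ _ _ _ _ hq).
  by case: hcases => -[t_sgn _ _]; rewrite ?(gt_eqF t_sgn) ?(lt_eqF t_sgn).
by move=> n; apply: qheun_sign_condition.
Qed.
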